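(* Let $M$ be a normal automaton over a finite alphabet $A$ and let $L=L(M)$ be the language accepted by $M$. Let $\phi:A^*\to G$ be a monoid homomorphism, where $G$ is a group with a left-invariant semi-metric $d_G$. Then there exists a number $\lambda=\lambda(M,\phi,d_G)\ge0$ such that for any initial distribution $\mu$ on $E(\Gamma(M))$ we have $$\frac{|\phi(w_n)|_G}{n}\to\lambda\quad\text{as } n\to\infty,\ \text{almost surely and in }L^1\text{ with respect to }P_\mu.$$
   Context: $|g|_G:=d_G(1,g)$. A nondeterministic finite automaton $M$ over $A$ with finite state set $Q$ is specified by a finite directed graph $\Gamma(M)$ with vertex set $Q$, whose directed edges are labelled by elements of $A$ (for a state $q$ and a letter $a$ there may be several, one, or no edges labelled $a$ with origin $q$), together with a nonempty set $I\subseteq Q$ of initial states and a set of accepting states. $M$ accepts a word $w$ if there is a directed path labelled $w$ in $\Gamma(M)$ from some initial state to an accepting state; $L(M)$ is the set of accepted words. $M$ is normal if: its set of accepting states is nonempty; $\Gamma(M)$ has at least one edge; and $\Gamma(M)$ is strongly connected, i.e. for any two states $q,q'$ there is a directed edge-path from $q$ to $q'$. Associated Markov chain $M'$: its state set is the set $E=E(\Gamma(M))$ of directed edges of $\Gamma(M)$; the transition probability is $p_{e,f}=0$ if the origin of $f$ is not the terminus of $e$, and $p_{e,f}=1/m$ otherwise, where $m$ is the number of outgoing directed edges from the terminus of $e$. The sample space $\Omega$ is the set of semi-infinite directed edge-paths $\omega=e_1,e_2,\dots$ in $\Gamma(M)$; $w_n=w_n(\omega)$ is the word of length $n$ over $A$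 that labels $e_1,\dots,e_n$. For an initial probability distribution $\mu$ on $E$, $P_\mu$ is the Borel probability measure on $\Omega$ giving the set of all $\omega$ with initial segment $e_1,\dots,e_n$ the mass $\mu(e_1)p_{e_1,e_2}\cdots p_{e_{n-1},e_n}$. *)

(* Defs.v *)
From HB Require Import structures.
From mathcomp Require Import all_boot all_order all_algebra.
From mathcomp Require Import all_classical all_reals all_analysis.

Set Implicit Arguments.
Unset Strict Implicit.
Unset Printing Implicit Defensive.

Import Order.TTheory GRing.Theory Num.Theory.
Import numFieldNormedType.Exports.

Local Open Scope classical_set_scope.
Local Open Scope ring_scope.

(* Edges form a finite type of their own: distinct parallel edges, even with
   equal labels, are allowed, and a state may have any number of outgoing
   edges with a given label. *)
Record automaton (A : finType) := Automaton {
  state : finType;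
  edge : finType;
  origin : edge -> state;
  terminus : edge -> state;
  label : edge -> A;
  initial : {set state};
  accepting : {set state};
  initial_neq0 : initial != finset.set0 }.

Arguments initial {A} a.
Arguments accepting {A} a.

Section Automaton.
Variables (A : finType) (M : automaton A).

Fixpoint directed_path (q : state M) (s : seq (edge M)) (q' : state M) : Prop :=
  if s is e :: s' then origin e = q /\ directed_path (terminus e) s' q'
  else q = q'.

Definition language : set (seq A) :=
  [set u | exists q s q', [/\ q \in initial M, q' \in accepting M,
                              directed_path q s q' & map (@label A M) s = u]].

Definition normal_automaton : Prop :=
  [/\ accepting M != finset.set0, (0 < #|edge M|)%N &
      forall q q' : state M, exists s, directed_path q s q'].

(* The path e_1, e_2, ... is the function w with w i = e_(i+1). *)
Definition edge_paths : set (nat -> edge M) :=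
  [set w | forall i, terminus (w i) = origin (w i.+1)].

Lemma edge_paths_neq0 : normal_automaton -> edge_paths !=set0.
Proof.
case=> _ /card_gt0P[e0 _] conn.
have next e : exists f : edge M, terminus e = origin f.
  by have [[|f s] /= ] := conn (terminus e) (origin e0);
    [exists e0 | case=> <- _; exists f].
pose f e := sval (cid (next e)).
by exists (fun i => iter i f e0) => i /=; rewrite /f; case: cid.
Qed.

(* Normality is an argument only because measurable types are pointed. *)
Definition path_space (hM : normal_automaton) : Type := edge_paths.

HB.instance Definition _ (hM : normal_automaton) :=
  Choice.copy (path_space hM) edge_paths.

Definition some_path (hM : normal_automaton) : path_space hM :=
  let h := cid (edge_paths_neq0 hM) in exist _ (sval h) (mem_set (svalP h)).

HB.instance Definition _ (hM : normal_automaton) :=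
  isPointed.Build (path_space hM) (some_path hM).

Section SampleSpace.
Variable hM : normal_automaton.

Definition edge_at (w : path_space hM) (i : nat) : edge M := val w i.

Definition prefix_word (w : path_space hM) (n : nat) : seq A :=
  mkseq (fun i => label (edge_at w i)) n.

Definition cylinder (s : seq (edge M)) : set (path_space hM) :=
  [set w | mkseq (edge_at w) (size s) = s].

(* The cylinders form a countable base of the topology induced on paths by the
   product of discrete topologies, so they generate its Borel sigma-algebra. *)
Definition sample_space : Type := g_sigma_algebraType (range cylinder).

HB.instance Definition _ := Measurable.on sample_space.

End SampleSpace.
End Automaton.

Arguments prefix_word {A M} hM w n.
Arguments cylinder {A M} hM s.

Section MarkovChain.
Variables (R : realType) (A : finType) (M : automaton A).

Definition outdegree (q : state M) : nat := #|[set f : edge M | origin f == q]%SET|.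

Definition transition (e f : edge M) : R :=
  if origin f == terminus e then (outdegree (terminus e))%:R^-1 else 0.

Definition distribution_on (T : finType) (mu : T -> R) : Prop :=
  (forall x, 0 <= mu x) /\ \sum_x mu x = 1.

(* This determines P, as the cylinders, together with the empty set, are stable
   under intersection and generate the sigma-algebra. *)
Definition markov_measure (hM : normal_automaton M) (mu : edge M -> R)
    (P : probability (sample_space hM) R) : Prop :=
  forall (e : edge M) (s : seq (edge M)),
    P (cylinder hM (e :: s)) =
    (mu e * \prod_(x <- zip (e :: s) s) transition x.1 x.2)%:E.

End MarkovChain.

Section SemiMetric.
Variables (R : realType) (G : groupType) (d : G -> G -> R).

Definition semi_metric : Prop :=
  [/\ forall x y, 0 <= d x y, forall x, d x x = 0,
      forall x y, d x y = d y x &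
      forall x y z, d x z <= d x y + d y z].

Definition left_invariant : Prop :=
  forall g x y : G, d (g * x)%g (g * y)%g = d x y.

Definition dist1 (g : G) : R := d 1%g g.

End SemiMetric.

Definition word_morphism (A : Type) (G : groupType) (phi : seq A -> G) : Prop :=
  phi [::] = 1%g /\ forall u v, phi (u ++ v) = (phi u * phi v)%g.

Section Convergence.
Context {dT : measure_display} {T : measurableType dT} {R : realType}.

Definition cvg_as (P : probability T R) (X : nat -> T -> R) (Y : T -> R) : Prop :=
  {ae P, forall w, X n w @[n --> \oo] --> Y w}.

Definition cvg_L1 (P : probability T R) (X : nat -> T -> R) (Y : T -> R) : Prop :=
  [/\ forall n, P.-integrable setT (EFin \o X n),
      P.-integrable setT (EFin \o Y) &
      (\int[P]_w `|X n w - Y w|%:E)%E @[n --> \oo] --> 0%E].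

End Convergence.

(* Main.v *)
Require Import Defs.
From HB Require Import structures.
From mathcomp Require Import all_boot all_order all_algebra.
From mathcomp Require Import all_classical all_reals all_analysis.
From mathcomp Require Import measurable_realfun ring lra.

(* Let F be the length |phi(.)|_G of the label of a path; it is subadditive.
   Put lambda = inf_n max_e E_e[F(e_1..e_n)] / n, where E_e is the expectation
   for the chain started at the edge e.
   Upper bound: choose k with max_e E_e[F(e_1..e_k)] <= (lambda + d) k.  The
   exponential moments max_e E_e[exp(t F(e_1..e_n))] are submultiplicative in
   n, so F exceeds (lambda + 2d) n along the multiples n of k with
   exponentially small probability, and Borel-Cantelli applies.
   Lower bound: for r < lambda the event that F(e_1..e_n) <= r n infinitely
   often is, up to adjusting r, shift-invariant, because F changes by a bounded
   amount when a letter is removed in front.  By irreducibility such an event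
   has probability 0 for every initial distribution or 1 for every one.  In the
   second case a path can be covered up to a small proportion by blocks of
   bounded length on which F <= r * length, which forces lambda <= r.
   The L^1 statement follows by dominated convergence. *)

Set Implicit Arguments.
Unset Strict Implicit.
Unset Printing Implicit Defensive.

Import Order.TTheory GRing.Theory Num.Theory.
Import numFieldNormedType.Exports.

Local Open Scope classical_set_scope.
Local Open Scope ring_scope.

(** * Expectations over finite paths of the chain *)

Section PathExpectation.
Variables (R : realType) (A : finType) (M : automaton A).
Hypothesis hM : normal_automaton M.

(** Some path leads from [q] to the origin of an edge; its first edge, or that edge itself if the
    path is empty, leaves [q]. *)
Lemma outdegree_gt0 (q : state M) : (0 < outdegree q)%N.
Proof.
case: hM => _ /card_gt0P[e0 _] conn.
apply/card_gt0P; case: (conn q (origin e0)) => [[|f s] /=].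
  by move=> ->; exists e0; rewrite inE.
by move=> [<- _]; exists f; rewrite inE.
Qed.

Lemma transition_ge0 (e f : edge M) : 0 <= transition R e f.
Proof. by rewrite /transition; case: ifP => // _; rewrite invr_ge0. Qed.

Lemma transition_gt0 (e f : edge M) :
  terminus e = origin f -> 0 < transition R e f.
Proof.
by move=> ef; rewrite /transition ef eqxx invr_gt0 ltr0n outdegree_gt0.
Qed.

Lemma transition_sum1 (e : edge M) : \sum_f transition R e f = 1.
Proof.
rewrite -big_mkcond /= sumr_const -cardsE -/(outdegree (terminus e)).
by rewrite -[LHS]mulr_natr mulVf // pnatr_eq0 -lt0n outdegree_gt0.
Qed.

(* The expectation of H (e_1, ..., e_n) for the chain started at e_1 = e. *)
Fixpoint path_expectation (n : nat) (H : seq (edge M) -> R) (e : edge M) : R :=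
  if n is n'.+1 then
    \sum_f transition R e f * path_expectation n' (fun s => H (e :: s)) f
  else H [::].

Local Notation E := path_expectation.

Lemma le_path_expectation n (H1 H2 : seq (edge M) -> R) e :
  (forall s, size s = n -> H1 s <= H2 s) -> E n H1 e <= E n H2 e.
Proof.
elim: n H1 H2 e => [|n IH] H1 H2 e H12 /=; first exact: H12.
apply: ler_sum => f _; rewrite ler_wpM2l ?transition_ge0 //.
by apply: IH => s sn; apply: H12; rewrite /= sn.
Qed.

Lemma eq_path_expectation n (H1 H2 : seq (edge M) -> R) e :
  (forall s, size s = n -> H1 s = H2 s) -> E n H1 e = E n H2 e.
Proof.
by move=> H12; apply/le_anti/andP; split; apply: le_path_expectation => s /H12 ->.
Qed.

Lemma path_expectation_cst n c e : E n (fun=> c) e = c.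
Proof.
elim: n e => [//|n IH] e /=.
under eq_bigr do rewrite IH.
by rewrite -big_distrl /= transition_sum1 mul1r.
Qed.

Lemma path_expectationD n (H1 H2 : seq (edge M) -> R) e :
  E n (fun s => H1 s + H2 s) e = E n H1 e + E n H2 e.
Proof.
elim: n H1 H2 e => [//|n IH] H1 H2 e /=.
by rewrite -big_split; apply: eq_bigr => f _; rewrite IH mulrDr.
Qed.

Lemma path_expectationZ n a (H : seq (edge M) -> R) e :
  E n (fun s => a * H s) e = a * E n H e.
Proof.
elim: n H e => [//|n IH] H e /=.
by rewrite big_distrr; apply: eq_bigr => f _; rewrite IH mulrCA.
Qed.

Lemma path_expectation_sum (I : Type) (r : seq I) n
    (H : I -> seq (edge M) -> R) e :
  E n (fun s => \sum_(i <- r) H i s) e = \sum_(i <- r) E n (H i) e.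
Proof.
elim: r => [|i r IH].
  by under eq_path_expectation do rewrite big_nil; rewrite path_expectation_cst big_nil.
under eq_path_expectation do rewrite big_cons.
by rewrite path_expectationD IH big_cons.
Qed.

(** Given the first [m] edges, the rest is a chain started at the random edge e_(m+1), so [c] has to
    be uniform in the starting edge. *)
Lemma path_expectation_markov m n (H1 H2 : seq (edge M) -> R) c e :
  (forall s, 0 <= H1 s) -> (forall f, E n H2 f <= c) ->
  E (m + n) (fun s => H1 (take m s) * H2 (drop m s)) e <= E m H1 e * c.
Proof.
move=> + H2c; elim: m H1 e => [|m IH] H1 e H1_ge0 /=.
  under eq_path_expectation do rewrite take0 drop0.
  by rewrite path_expectationZ ler_wpM2l.
rewrite big_distrl; apply: ler_sum => f _ /=; rewrite -mulrA.
by rewrite ler_wpM2l ?transition_ge0 //; exact: IH.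
Qed.

Lemma path_expectation_drop m n (H : seq (edge M) -> R) c e :
  (forall f, E n H f <= c) -> E (m + n) (fun s => H (drop m s)) e <= c.
Proof.
move=> Hc; have := @path_expectation_markov m n (fun=> 1) H c e (fun=> ler01) Hc.
by rewrite path_expectation_cst mul1r; under eq_path_expectation do rewrite mul1r.
Qed.

Lemma path_expectation_take m n (H : seq (edge M) -> R) e :
  E (m + n) (fun s => H (take m s)) e = E m H e.
Proof.
elim: m H e => [|m IH] H e /=.
  under eq_path_expectation do rewrite take0.
  by rewrite path_expectation_cst.
by apply: eq_bigr => f _; rewrite -IH.
Qed.

(* Harmonic functions on a finite strongly connected graph attain their
   minimum, and the minimum propagates along edges. *)
Lemma harmonic_cst (h : edge M -> R) :
  (forall e, h e = \sum_f transition R e f * h f) -> forall e f, h e = h f.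
Proof.
move=> harm.
case: hM => _ /card_gt0P[e0 _] conn.
pose m := [arg min_(e < e0) h e]%O.
have hm f : h m <= h f.
  by rewrite /m; case: Order.TotalTheory.arg_minP => // i _ /(_ f isT).
have step e f : h e = h m -> terminus e = origin f -> h f = h m.
  move=> he ef; have := harm e.
  rewrite he => /eqP; rewrite -[X in X == _]mul1r -(transition_sum1 e).
  rewrite big_distrl eq_sym -subr_eq0 -sumrB psumr_eq0 /=; last first.
    by move=> g _; rewrite -mulrBr mulr_ge0 ?transition_ge0 ?subr_ge0.
  move=> /allP/(_ f); rewrite mem_index_enum => /(_ isT) /=.
  by rewrite -mulrBr mulf_eq0 gt_eqF ?transition_gt0 //= subr_eq0 => /eqP.
suff all f : h f = h m by move=> e f; rewrite !all.
have [s] := conn (terminus m) (origin f).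
have : h m = h m by [].
(* The path may now start at any edge where [h] takes its minimal value. *)
move: {1 3}m; elim: s => [|g s IH] e he /=; first exact: step he.
by case=> eg; apply: IH; apply: (step e).
Qed.

End PathExpectation.

(** * Drift and exponential upper deviations *)

Lemma expR_le1DxDxx (R : realType) (x : R) :
  x <= 2^-1 -> expR x <= 1 + x + 2 * x ^+ 2.
Proof.
move=> x2; have : 1 - x <= (expR x)^-1 by rewrite -expRN expR_ge1Dx.
have e0 := expR_gt0 x.
rewrite -[_^-1]mul1r ler_pdivlMr // => h.
(* (1 + x + 2x^2)(1 - x) = 1 + x^2 (1 - 2x), while exp x (1 - x) <= 1. *)
have h1 : 0 <= x ^+ 2 * (1 - 2 * x) by rewrite mulr_ge0 ?sqr_ge0 //; lra.
have {}h1 : 1 <= (1 + x + 2 * x ^+ 2) * (1 - x) by nra.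
rewrite -(ler_pM2l (_ : 0 < 1 - x)); last lra.
by rewrite (le_trans h) // mulrC.
Qed.

Section Drift.
Variables (R : realType) (A : finType) (M : automaton A).
Hypothesis hM : normal_automaton M.
Variables (F : seq (edge M) -> R) (C : R).
Hypotheses (F_ge0 : forall s, 0 <= F s)
  (F_cat : forall s t, F (s ++ t) <= F s + F t)
  (F_size : forall s, F s <= C * (size s)%:R).

Local Notation E := path_expectation.

Lemma bound_ge0 : 0 <= C.
Proof.
case: hM => _ /card_gt0P[e0 _] _.
by have := F_size [:: e0]; rewrite mulr1; apply: le_trans.
Qed.

(** Taking all upper bounds [x] of the ratios avoids forming a maximum over edges and leaves the
    infimum unchanged. *)
Let rates : set R :=
  [set x | exists2 n, (0 < n)%N & forall e, E n F e <= x * n%:R].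

(* The rate of escape: the infimum over n > 0 of max_e E_e[F(e_1..e_n)] / n. *)
Definition drift : R := inf rates.

Let rates_ge0 x : rates x -> 0 <= x.
Proof.
case=> n n0 H; case: hM => _ /card_gt0P[e0 _] _.
have : 0 <= x * n%:R.
  apply: le_trans (H e0); rewrite -[leLHS](path_expectation_cst hM n 0 e0).
  by apply: le_path_expectation.
by rewrite pmulr_lge0 // ltr0n.
Qed.

Let has_inf_rates : has_inf rates.
Proof.
split; last by exists 0 => x /rates_ge0.
exists C, 1%N => // e.
rewrite -[leRHS](path_expectation_cst hM 1 _ e).
by apply: le_path_expectation => s <-; exact: F_size.
Qed.

Lemma drift_ge0 : 0 <= drift.
Proof. by apply: lb_le_inf; [case: has_inf_rates | move=> x /rates_ge0]. Qed.

Lemma drift_le n x : (0 < n)%N -> (forall e, E n F e <= x * n%:R) -> drift <= x.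
Proof. by move=> n0 H; apply: ge_inf; [case: has_inf_rates | exists n]. Qed.

Lemma drift_adherent d : 0 < d ->
  exists2 k, (0 < k)%N & forall e, E k F e <= (drift + d) * k%:R.
Proof.
move=> d0; have [x [k k0 H] xd] := inf_adherent d0 has_inf_rates.
exists k => // e; apply: le_trans (H e) _.
by rewrite ler_wpM2r // ltW.
Qed.

(** For [t >= 0], subadditivity of [F] makes exp(t F) submultiplicative under concatenation; the
    Markov property splits off one block of [k] letters at a time. *)
Lemma path_expectation_expR_mul t k c : 0 <= t ->
  (forall e, E k (fun s => expR (t * F s)) e <= c) ->
  forall J e, E (J * k) (fun s => expR (t * F s)) e <= c ^+ J.
Proof.
move=> t0 Hc.
have c0 : 0 <= c.
  case: hM => _ /card_gt0P[e0 _] _; apply: le_trans (Hc e0).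
  rewrite -[leLHS](path_expectation_cst hM k 0 e0).
  by apply: le_path_expectation => s _; exact: expR_ge0.
elim=> [|J IH] e.
  rewrite mul0n expr0 /=; have -> : F [::] = 0.
    by apply/le_anti; rewrite F_ge0 andbT; have := F_size [::]; rewrite mulr0.
  by rewrite mulr0 expR0.
rewrite mulSn exprS.
pose H s := expR (t * F s).
apply: le_trans (_ : E (k + J * k)
    (fun s => H (take k s) * H (drop k s)) e <= _).
  apply: le_path_expectation => s _.
  by rewrite /H -expRD ler_expR -mulrDr ler_wpM2l // -{1}(cat_take_drop k s).
apply: le_trans (path_expectation_markov k e _ IH) _; first by move=> s; exact: expR_ge0.
by rewrite ler_wpM2r ?exprn_ge0.
Qed.

(** Chernoff bound: a block of [k] letters has mean at most (drift + d/2) k, and for small [t] the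
    second-order term of its exponential moment uses up only half of the remaining margin. *)
Lemma drift_upper_deviation d : 0 < d -> exists k (rho : R),
  [/\ (0 < k)%N, 0 <= rho < 1 & forall J e,
    E (J * k) (fun s => ((drift + d) * (J * k)%:R < F s)%R%:R : R) e <= rho ^+ J].
Proof.
move=> d0; have d20 : 0 < d / 2 by lra.
have [k k0 Hk] := drift_adherent d20.
have kR : 0 < k%:R :> R by rewrite ltr0n.
have C0 := bound_ge0.
(* [D] bounds [F] on [k] letters; the added 1 makes it positive. *)
pose D := C * k%:R + 1.
have D1 : 1 <= D by rewrite lerDr mulr_ge0.
have D0 : 0 < D by lra.
pose q := d * k%:R / 8.
have q0 : 0 < q by rewrite divr_gt0 ?mulr_gt0.
(* Ensures t F <= 1/2, the range of [expR_le1DxDxx], and 2 (t F)^2 <= 2 t q. *)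
pose t := Num.min (2^-1 / D) (q / D ^+ 2).
have t0 : 0 < t by rewrite lt_min; apply/andP; split; rewrite divr_gt0 ?exprn_gt0 ?invr_gt0.
have tD : t * D <= 2^-1 by rewrite -ler_pdivlMr // ge_min lexx.
have tD2 : t * D ^+ 2 <= q by rewrite -ler_pdivlMr ?exprn_gt0 // ge_min lexx orbT.
pose m := (drift + d / 2) * k%:R.
pose c := expR (t * (m + 2 * q)).
have Hc e : E k (fun s => expR (t * F s)) e <= c.
  apply: le_trans (_ : 1 + t * (m + 2 * q) <= _); last exact: expR_ge1Dx.
  apply: le_trans (_ : E k (fun s => (1 + 2 * t * q) + t * F s) e <= _).
    apply: le_path_expectation => s sk.
    have FD : F s <= D.
      by apply: le_trans (F_size s) _; rewrite sk /D; lra.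
    have F0 := F_ge0 s.
    have tFD : t * F s <= t * D by rewrite ler_wpM2l // ltW.
    apply: le_trans (expR_le1DxDxx _) _; first exact: le_trans tFD tD.
    have : t * F s ^+ 2 <= q.
      by apply: le_trans tD2; rewrite ler_wpM2l ?(ltW t0) // lerXn2r // nnegrE ltW.
    move=> h; have : t * (t * F s ^+ 2) <= t * q by rewrite ler_wpM2l // ltW.
    by move=> h'; rewrite exprMn expr2; lra.
  rewrite path_expectationD // path_expectation_cst // path_expectationZ //.
  have : t * E k F e <= t * m by rewrite ler_wpM2l ?(ltW t0) // Hk.
  by lra.
(* Per block the threshold is (drift + d) k = m + 4q and the moment bound has m + 2q; the gap 2q
   gives the rate. *)
exists k, (expR (- (t * (2 * q)))); split => //.
  by rewrite expR_ge0 expR_lt1 oppr_lt0 mulr_gt0 //; lra.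
move=> J e.
pose a : R := (drift + d) * (J * k)%:R.
(* Markov's inequality for exp(t F). *)
apply: le_trans (_ : E (J * k) (fun s => expR (- (t * a)) * expR (t * F s)) e <= _).
  apply: le_path_expectation => s _; rewrite -expRD.
  case: ltP => [h|_]; last exact: expR_ge0.
  rewrite (_ : 1%:R = expR 0) ?expR0 // -{1}expR0 ler_expR.
  by rewrite addrC -mulrBr mulr_ge0 ?(ltW t0) // subr_ge0 ltW.
rewrite path_expectationZ //.
apply: le_trans (_ : expR (- (t * a)) * c ^+ J <= _).
  by rewrite ler_wpM2l ?expR_ge0 //; exact: path_expectation_expR_mul (ltW t0) Hc J e.
rewrite -!expRM_natl -expRD ler_expR le_eqVlt; apply/orP; left; apply/eqP.
by rewrite /a /m /q natrM; field.
Qed.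

(** * Covering a path by blocks of bounded length *)

Definition bad (r : R) (N : nat) (s : seq (edge M)) : bool :=
  all (fun m => r * m.+1%:R < F (take m.+1 s)) (iota 0 N).

(* Katznelson-Weiss covering: from left to right, cut off a prefix of length
   m <= N with F <= r m when there is one, a single letter otherwise. *)
Lemma subadditive_cover r N n s :
  F (take n s) <= r * n%:R
    + (C + `|r|) * (\sum_(i < n) (bad r N (drop i s))%:R)
    + (C + `|r|) * N%:R.
Proof.
have C0 := bound_ge0.
have r0 := normr_ge0 r; have rr := ler_norm r.
have rr' : - r <= `|r| by rewrite -normrN ler_norm.
have FC m u : F (take m u) <= C * m%:R.
  apply: le_trans (F_size _) _; rewrite ler_wpM2l // ler_nat size_take_min.
  exact: geq_minl.
have [p] := ubnP n; elim: p => // p IH in n s *; rewrite ltnS => np.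
have [->|n0] := posnP n.
  rewrite big_ord0 mulr0; apply: le_trans (FC _ _) _.
  by rewrite !mulr0 !add0r mulr_ge0 // addr_ge0.
have [sb|] := boolP (bad r N s).
  (* The single letter costs at most [C <= r + (C + |r|)], charged to this bad position. *)
  case: n n0 np => // n _ np; rewrite big_ord_recl drop0 sb /=.
  have := F_cat (take 1 s) (take n (drop 1 s)).
  rewrite -takeD add1n => h.
  have := IH n (drop 1 s) np.
  have := FC 1%N s; rewrite mulr1 => h1 h2.
  rewrite -[n.+1%:R]natr1.
  apply: le_trans h _; apply: le_trans (lerD h1 h2) _.
  rewrite (eq_bigr (fun i : 'I_n => (bad r N (drop (lift ord0 i) s))%:R)); last first.
    by move=> i _; rewrite drop_drop addn1.
  by lra.
rewrite /bad -has_predC => /hasP[m]; rewrite mem_iota /= add0n -leNgt => mN Hm.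
have S0 : 0 <= \sum_(i < n) (bad r N (drop i s))%:R :> R by apply: sumr_ge0.
(* If the block overshoots, fewer than [N] letters remain, and the last term pays for them. *)
have [mn|nm] := leqP m.+1 n; last first.
  apply: le_trans (FC _ _) _.
  have : n%:R <= N%:R :> R by rewrite ler_nat (leq_trans _ mN) // ltnW.
  have : 0 <= n%:R :> R by [].
  have : 0 <= (C + `|r|) * \sum_(i < n) (bad r N (drop i s))%:R by rewrite mulr_ge0 // addr_ge0.
  by nra.
have := F_cat (take m.+1 s) (take (n - m.+1) (drop m.+1 s)).
rewrite -takeD subnKC // => h.
have := IH (n - m.+1)%N (drop m.+1 s) ltac:(by rewrite (leq_trans _ np) // ltn_subrL).
rewrite natrB // => h2.
have h3 : \sum_(i < n - m.+1) (bad r N (drop i (drop m.+1 s)))%:R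
          <= \sum_(i < n) (bad r N (drop i s))%:R :> R.
  rewrite -(big_mkord xpredT (fun i => (bad r N (drop i (drop m.+1 s)))%:R)).
  rewrite -(big_mkord xpredT (fun i => (bad r N (drop i s))%:R)).
  rewrite [leRHS](big_cat_nat (n := m.+1)) //=.
  have -> : \sum_(m.+1 <= i < n) (bad r N (drop i s))%:R
            = \sum_(0 <= i < n - m.+1) (bad r N (drop i (drop m.+1 s)))%:R :> R.
    rewrite -[in LHS](add0n m.+1) big_addn.
    by apply: eq_bigr => i _; rewrite drop_drop.
  by rewrite lerDr; apply: sumr_ge0.
have : (C + `|r|) * \sum_(i < n - m.+1) (bad r N (drop i (drop m.+1 s)))%:R
          <= (C + `|r|) * \sum_(i < n) (bad r N (drop i s))%:R.
  by rewrite ler_wpM2l // addr_ge0.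
by lra.
Qed.

(** Average [subadditive_cover]: each position is bad with probability at most [eta], whatever edge
    stands there, and the boundary term becomes negligible after division by a large [n]. *)
Lemma drift_le_bad r N eta :
  (forall j e, E (N + j) (fun s => (bad r N s)%:R : R) e <= eta) ->
  drift <= r + (C + `|r|) * eta.
Proof.
move=> Heta; set K := C + `|r|.
have K0 : 0 <= K by rewrite addr_ge0 ?bound_ge0.
apply/ler_addgt0Pr => d d0.
pose n := (Num.bound (K * N%:R / d)).+1.
have nR : 0 < n%:R :> R by rewrite ltr0n.
have Kn : K * N%:R <= d * n%:R.
  rewrite mulrC mulrC [leRHS]mulrC -ler_pdivrMr //.
  apply: le_trans (_ : (Num.bound (K * N%:R / d))%:R <= _); last by rewrite ler_nat.
  by rewrite ltW // archi_boundP // divr_ge0 ?mulr_ge0 // ltW.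
apply: (@drift_le n) => // e.
rewrite -(path_expectation_take hM n N F e).
apply: le_trans (le_path_expectation _ (fun s _ => subadditive_cover r N n s)) _.
under eq_path_expectation do rewrite addrAC.
rewrite path_expectationD path_expectation_cst // path_expectationZ.
rewrite path_expectation_sum //.
have : \sum_(i < n) E (n + N) (fun s => (bad r N (drop i s))%:R) e <= \sum_(i < n) eta.
  apply: ler_sum => i _.
  (* Reading [n + N] letters leaves at least the [N] letters that [bad] inspects after position
     [i]. *)
  have -> : (n + N = i + (N + (n - i)))%N by rewrite addnCA addnC subnKC // ltnW.
  exact: (path_expectation_drop hM i e (Heta (n - i)%N)).
rewrite sumr_const card_ord -[eta *+ _]mulr_natr => h.
have := ler_wpM2l K0 h.
by rewrite -/K; lra.
Qed.

End Drift.

(** * The shift and the cylinders of the sample space *)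

Section Shift.
Variables (A : finType) (M : automaton A) (hM : normal_automaton M).

Local Notation Omega := (sample_space hM).
Local Notation cyl := (@cylinder A M hM : seq (edge M) -> set Omega).

Local Notation edge_at := (@Defs.edge_at A M hM).

Definition path_prefix (w : Omega) (n : nat) : seq (edge M) :=
  mkseq (edge_at w) n.

Lemma edge_paths_shift (w : Omega) : @edge_paths A M (fun i => val w i.+1).
Proof. by move=> i; have := set_mem (valP w); apply. Qed.

Definition path_shift (w : Omega) : Omega :=
  exist _ (fun i => val w i.+1) (mem_set (edge_paths_shift w)).

Lemma edge_at_shift k (w : Omega) i :
  edge_at (iter k path_shift w) i = edge_at w (k + i).
Proof. by elim: k i => [//|k IH] i; rewrite iterS addSnnS -IH. Qed.

Lemma path_prefix_shift k n (w : Omega) :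
  path_prefix (iter k path_shift w) n = drop k (path_prefix w (k + n)).
Proof.
rewrite /path_prefix /mkseq iotaD map_cat drop_size_cat ?size_map ?size_iota //.
have -> : iota (0 + k) n = map (addn k) (iota 0 n) by rewrite -iotaDl addn0.
rewrite -map_comp.
by apply: eq_map => i; rewrite /= edge_at_shift.
Qed.

Lemma take_path_prefix m n (w : Omega) : (m <= n)%N ->
  take m (path_prefix w n) = path_prefix w m.
Proof. by move=> mn; rewrite /path_prefix /mkseq -map_take take_iota (minn_idPl mn). Qed.

Lemma cylinder_nil : cyl [::] = setT.
Proof. by apply/seteqP; split. Qed.

Lemma cylinder_cat (s t : seq (edge M)) (w : Omega) :
  cyl (s ++ t) w <-> cyl s w /\ cyl t (iter (size s) path_shift w).
Proof.
rewrite /cylinder /= -/(path_prefix _ _) -/(path_prefix w _) -/(path_prefix _ _).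
rewrite size_cat path_prefix_shift.
rewrite -(@take_path_prefix (size s) (size s + size t) w) ?leq_addr //.
split=> [->|[h1 h2]]; first by rewrite take_size_cat // drop_size_cat.
by rewrite -[LHS](cat_take_drop (size s)) h1 h2.
Qed.

Lemma cylinder_headI (e f : edge M) s : e != f ->
  cyl [:: e] `&` cyl (f :: s) = set0.
Proof.
move=> ef; apply/seteqP; split => // w [/= [h1]].
by rewrite /cylinder /= => -[h2 _]; move: ef; rewrite -h1 -h2 eqxx.
Qed.

(** Shifting by [size s] keeps the edge [e], so the two words overlap in one letter; a chain
    restarted at [e] has [e] as its first edge. *)
Lemma cylinder_shiftI (s t : seq (edge M)) e f :
  cyl (rcons s e) `&` (iter (size s) path_shift) @^-1` cyl (f :: t) =
  if f == e then cyl (rcons s e ++ t) else set0.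
Proof.
have [->|fe] := eqVneq f e.
  rewrite cat_rcons -[in LHS]cats1; apply/seteqP; split => w.
    by case=> /cylinder_cat[h1 h2] h3; apply/cylinder_cat.
  move=> /cylinder_cat[h1 h2]; split => //; apply/cylinder_cat; split => //.
  by move: h2; rewrite -[e :: t]cat1s => /cylinder_cat[].
apply/seteqP; split => // w [].
rewrite -cats1 => /cylinder_cat[_ h1] h2.
have ef : e != f by rewrite eq_sym.
have : (cyl [:: e] `&` cyl (f :: t)) (iter (size s) path_shift w) by [].
by rewrite cylinder_headI.
Qed.

(** The shorter word either is a prefix of the longer one or disagrees with it. *)
Lemma cylinderI (s t : seq (edge M)) :
  cyl s `&` cyl t = set0 \/ exists u, cyl s `&` cyl t = cyl u.
Proof.
wlog st : s t / (size s <= size t)%N.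
  move=> H; have [/H//|/ltnW/H] := leqP (size s) (size t).
  by rewrite setIC.
have [ts|ts] := eqVneq (take (size s) t) s; [right; exists t|left].
  apply/seteqP; split=> [w []//|w]; rewrite -(cat_take_drop (size s) t) ts.
  by move=> /[dup] /cylinder_cat[].
apply/seteqP; split => // w [h1].
rewrite -{1}(cat_take_drop (size s) t) => /cylinder_cat[h2 _].
case/eqP: ts; rewrite -[RHS]h1 -[LHS]h2; congr (mkseq _ _).
by rewrite size_take_min (minn_idPl st).
Qed.

Lemma measurable_cylinder s : measurable (cyl s).
Proof. by apply: sub_sigma_algebra; exists s. Qed.

(** There are finitely many words of length [n], so an event decided by [n] edges is a finite union
    of cylinders. *)
Lemma measurable_path_prefix (S : set (seq (edge M))) n :
  measurable [set w : Omega | S (path_prefix w n)].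
Proof.
rewrite (_ : [set w | _] = \bigcup_(t in [set t : n.-tuple (edge M) | S t]) cyl t).
  by apply: fin_bigcup_measurable => // t _; exact: measurable_cylinder.
apply/seteqP; split => w /=.
  move=> Sw; have sz : size (path_prefix w n) == n by rewrite size_mkseq.
  by exists (Tuple sz) => //=; rewrite /cylinder /= !size_mkseq.
by case=> t /= St; rewrite /cylinder /= size_tuple /path_prefix => ->.
Qed.

Lemma measurable_shift k : measurable_fun setT (iter k path_shift).
Proof.
apply: (measurability (range cyl)) => //.
move=> _ [_ [s _ <-] <-]; rewrite setTI.
rewrite (_ : _ @^-1` _ = [set w | drop k (path_prefix w (k + size s)) = s]).
  exact: (measurable_path_prefix (fun u => drop k u = s)).
by apply/seteqP; split => w /=; rewrite -path_prefix_shift.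
Qed.

(** Cylinders and the empty set form a generating pi-system, which contains the whole space as the
    cylinder of the empty word. *)
Lemma eq_measure_cylinder (R : realType) (m1 m2 : {measure set Omega -> \bar R}) :
  (m1 setT < +oo)%E -> (forall s, m1 (cyl s) = m2 (cyl s)) ->
  forall D, measurable D -> m1 D = m2 D.
Proof.
move=> m1oo m12 D mD.
pose G := range cyl `|` [set set0].
apply: (measure_unique G (fun=> setT)) => //.
- apply/seteqP; split.
    apply: smallest_sub; first exact: smallest_sigma_algebra.
    by move=> X GX; apply: sub_sigma_algebra; left.
  apply: smallest_sub; first exact: sigma_algebra_measurable.
  move=> _ [[s _ <-]|->]; [exact: measurable_cylinder|exact: measurable0].
- move=> X Y [[s _ <-]|->]; last by rewrite set0I; right.
  move=> [[t _ <-]|->]; last by rewrite setI0; right.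
  by case: (cylinderI s t) => [->|[u ->]]; [right|left; exists u].
- by move=> _; left; exists [::] => //; exact: cylinder_nil.
- by apply/seteqP; split => // w _; exists 0%N.
- by move=> _ [[s _ <-]|->]; rewrite ?measure0.
Qed.

Lemma measure_partition_head (R : realType) (m : {measure set Omega -> \bar R}) D :
  measurable D -> m D = (\sum_e m (cyl [:: e] `&` D))%E.
Proof.
move=> mD; have {1}-> : D = \bigcup_(e in [set: edge M]) (cyl [:: e] `&` D).
  apply/seteqP; split => w; last by case=> e _ [].
  by move=> Dw; exists (edge_at w 0).
rewrite measure_fin_bigcup //.
- rewrite [RHS]bigfs ?index_enum_uniq // => [|e _]; last by rewrite mem_index_enum.
  by congr (\big[_/_]_(_ \in _) _); apply/seteqP; split.
- exact: finite_finset.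
- apply/trivIsetP => e f _ _ ef; rewrite setIACA (cylinder_headI [::] ef) set0I //.
- by move=> e _; apply: measurableI => //; exact: measurable_cylinder.
Qed.

End Shift.

(** * Chains started at single edges, the Markov property and the zero-one law *)

Section MarkovFamily.
Variables (R : realType) (A : finType) (M : automaton A).
Variable hM : normal_automaton M.

Local Notation Omega := (sample_space hM).
Local Notation cyl := (@cylinder A M hM : seq (edge M) -> set Omega).
Local Notation T := (@path_shift A M hM).
Local Notation E := path_expectation.

Definition path_weight (e : edge M) (s : seq (edge M)) : R :=
  \prod_(x <- zip (e :: s) s) transition R x.1 x.2.

Lemma path_weight_cons e f s :
  path_weight e (f :: s) = transition R e f * path_weight f s.
Proof. by rewrite /path_weight /= big_cons. Qed.

Lemma path_weight_cat e s f t :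
  path_weight e (rcons s f ++ t) = path_weight e (rcons s f) * path_weight f t.
Proof.
elim: s e => [|g s IH] e /=; last by rewrite !path_weight_cons IH mulrA.
by rewrite !path_weight_cons {2}/path_weight /= big_nil mulr1.
Qed.

Lemma path_weight_gt0 e s f :
  directed_path (terminus e) s (origin f) -> 0 < path_weight e (rcons s f).
Proof.
elim: s e => [|g s IH] e /=.
  move=> ef; rewrite path_weight_cons {1}/path_weight /= big_nil mulr1.
  exact: (transition_gt0 R hM).
by case=> eg gf; rewrite path_weight_cons mulr_gt0 ?IH // (transition_gt0 R hM).
Qed.

Definition start_at (e x : edge M) : R := (x == e)%:R.

Lemma markov_cylinder_cat mu (P : probability Omega R) s e t :
  markov_measure mu P ->
  P (cyl (rcons s e ++ t)) = (P (cyl (rcons s e)) * (path_weight e t)%:E)%E.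
Proof.
move=> hP; case: s => [|f s] /=; rewrite !hP -EFinM.
  by rewrite /= big_nil mulr1.
by rewrite -/(path_weight _ _) path_weight_cat mulrA.
Qed.

(** Restrict to [C], then push forward. Being a measure in [D], the result can be compared with
    others on cylinders alone. *)
Lemma exists_restr_shift (P : probability Omega R)
    (C : set Omega) k :
  measurable C -> exists m : {measure set Omega -> \bar R},
    forall D, m D = P (iter k T @^-1` D `&` C).
Proof.
move=> mC.
by unshelve eexists (pushforward (mrestr P mC) (iter k T) : {measure set Omega -> \bar R});
  [exact: measurable_shift|].
Qed.

(** [P] itself supplies these chains: connectivity gives a cylinder of positive probability ending
    in [e]; condition on it and shift until [e] comes first. *)
Lemma exists_markov_family mu (P : probability Omega R) :
  distribution_on mu -> markov_measure mu P ->
  exists Q : edge M -> probability Omega R,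
    forall e, markov_measure (start_at e) (Q e).
Proof.
move=> [mu0 mu1] hP.
have [e1 mue1] : exists e1, 0 < mu e1.
  apply: contrapT => /forallNP mu_le0.
  have : \sum_x mu x = 0.
    apply: big1 => x _; apply/le_anti; rewrite mu0 andbT leNgt.
    by apply/negP; exact: mu_le0.
  by rewrite mu1 => /eqP; rewrite oner_eq0.
suff /choice[Q HQ] : forall e, exists Qe : probability Omega R,
  markov_measure (start_at e) Qe by exists Q.
move=> e.
have [s Ps] : exists s, (0 < P (cyl (rcons s e)))%E.
  have [_ _ conn] := hM; have [s es] := conn (terminus e1) (origin e).
  exists (e1 :: s); rewrite /= hP lte_fin mulr_gt0 //.
  exact: path_weight_gt0.
have [m mE] := exists_restr_shift P (size s) (@measurable_cylinder A M hM (rcons s e)).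
have mT : m setT = P (cyl (rcons s e)) by rewrite mE preimage_setT setTI.
have Poo : P (cyl (rcons s e)) \is a fin_num by apply: fin_num_measure; exact: measurable_cylinder.
(* [mnormalize] falls back to [P] when the total mass is 0 or infinite; both are excluded here. *)
have nE D : mnormalize m P D = (m D * ((fine (P (cyl (rcons s e))))^-1)%:E)%E.
  rewrite /mnormalize mT ifF // gt_eqF //=.
  by apply/eqP => Pe; move: Poo; rewrite Pe.
exists (mnormalize m P) => f t.
rewrite -[LHS]/(mnormalize m P (cyl (f :: t))) nE mE setIC cylinder_shiftI.
rewrite /start_at -/(path_weight f t); have [->|_] := eqVneq f e; last first.
  by rewrite measure0 !mul0r mul0e.
rewrite (markov_cylinder_cat _ _ _ hP) mul1r -{1}(fineK Poo) -!EFinM.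
by rewrite mulrAC mulfV ?mul1r // fine_eq0 // gt_eqF.
Qed.

Variable Q : edge M -> probability Omega R.
Hypothesis hQ : forall e, markov_measure (start_at e) (Q e).

(** Both sides are finite measures in [D]. On the cylinder of [f :: t] both vanish unless [f = e],
    and then the path weights multiply. *)
Lemma markov_property mu (P : probability Omega R) s e D :
  markov_measure mu P -> measurable D ->
  P (cyl (rcons s e) `&` iter (size s) T @^-1` D) = (P (cyl (rcons s e)) * Q e D)%E.
Proof.
move=> hP mD.
have mC := @measurable_cylinder A M hM (rcons s e).
have [m mE] := exists_restr_shift P (size s) mC.
have Poo : P (cyl (rcons s e)) \is a fin_num by exact: fin_num_measure.
have c0 : 0 <= fine (P (cyl (rcons s e))) by exact: fine_ge0.
pose m2 : {measure set Omega -> \bar R} := mscale (NngNum c0) (Q e).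
have sE B : m2 B = (P (cyl (rcons s e)) * Q e B)%E by rewrite /m2 /= /mscale /= fineK.
rewrite setIC -mE -sE.
apply: (eq_measure_cylinder (m1 := m) (m2 := m2)) => // [|[|f t]].
- by rewrite mE preimage_setT setTI ltey_eq Poo.
- by rewrite cylinder_nil sE mE preimage_setT setTI probability_setT mule1.
rewrite sE mE setIC cylinder_shiftI hQ -/(path_weight f t).
rewrite /start_at; have [->|_] := eqVneq f e; last by rewrite measure0 mul0r mule0.
by rewrite (markov_cylinder_cat _ _ _ hP) mul1r.
Qed.

(** [P] is a mixture of the chains [Q e], so an event null for all of them is null for [P]. *)
Lemma markov_start mu (P : probability Omega R) D :
  markov_measure mu P -> measurable D -> P D = (\sum_e (mu e)%:E * Q e D)%E.
Proof.
move=> hP mD; rewrite measure_partition_head //; apply: eq_bigr => e _.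
rewrite -[LHS]/(P (cyl (rcons [::] e) `&` iter (size (@nil (edge M))) T @^-1` D)).
rewrite (@markov_property mu P [::] e D) //= hP.
by rewrite /= big_nil mulr1.
Qed.

(** Condition on the second edge; [D'] is [D] as seen from the shifted path. *)
Lemma markov_step e D D' :
  measurable D -> measurable D' ->
  (forall w f, cyl [:: e; f] w -> D w <-> D' (T w)) ->
  Q e D = (\sum_f (transition R e f)%:E * Q f D')%E.
Proof.
move=> mD mD' DD'.
have mC : measurable (cyl [:: e] `&` D).
  by apply: measurableI => //; exact: measurable_cylinder.
(* [Q e] is concentrated on the paths with first edge [e]. *)
have -> : Q e D = Q e (cyl [:: e] `&` D).
  rewrite measure_partition_head // (bigD1 e) //= big1 ?adde0 // => f fe.
  apply/eqP; rewrite eq_le measure_ge0 andbT.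
  have -> : 0%E = Q e (cyl [:: f]) :> \bar R.
    by rewrite hQ /start_at (negbTE fe) mul0r.
  apply: le_measure => //; rewrite ?inE; last exact: measurable_cylinder.
  by apply: measurableI => //; exact: measurable_cylinder.
have [m mE] := exists_restr_shift (Q e) 1 mC.
(* This makes the probability the total mass of [m], which splits by the first edge of the shifted
   path. *)
rewrite (_ : cyl _ `&` D = iter 1 T @^-1` setT `&` (cyl [:: e] `&` D)).
  rewrite -mE measure_partition_head //; apply: eq_bigr => f _.
  rewrite setIT mE.
  have -> : iter 1 T @^-1` cyl [:: f] `&` (cyl [:: e] `&` D) =
            cyl (rcons [:: e] f) `&` iter (size [:: e]) T @^-1` D'.
    have H w : cyl [:: e; f] w <-> cyl [:: e] w /\ cyl [:: f] (T w).
      exact: (cylinder_cat [:: e] [:: f]).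
    apply/seteqP; split => w.
      move=> [h1 [h2 h3]]; have h4 : cyl [:: e; f] w by apply/H.
      by split => //; apply/(DD' _ _ h4).
    by move=> [h1 h2]; have [h3 h4] := (H w).1 h1; do ! split => //; apply/(DD' _ _ h1).
  rewrite (markov_property _ _ (hQ e)) // hQ /= big_cons big_nil /start_at eqxx.
  by rewrite mul1r mulr1.
by rewrite preimage_setT setTI.
Qed.

(** Both sides satisfy the same one-step recursion; this carries bounds on [path_expectation] over
    to the measures. *)
Lemma markov_prefix n (b : pred (seq (edge M))) e :
  Q e [set w | b (path_prefix w n)] = (E n (fun s => (b s)%:R) e)%:E.
Proof.
elim: n b e => [|n IH] b e.
  case: (boolP (b [::])) => b0 /=; rewrite ?(negbTE b0) ?b0.
    by rewrite (_ : [set _ | _] = setT) ?probability_setT //; apply/seteqP; split.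
  by rewrite (_ : [set _ | _] = set0) ?measure0 //; apply/seteqP; split.
rewrite (@markov_step e _ [set w | b (e :: path_prefix w n)]).
- by rewrite /= -sumEFin; apply: eq_bigr => f _; rewrite (IH (fun s => b (e :: s))) EFinM.
- exact: (measurable_path_prefix (fun s => b s) _).
- exact: (measurable_path_prefix (fun s => b (e :: s)) _).
- move=> w f; rewrite -[[:: e; f]]cat1s => /cylinder_cat[+ _].
  rewrite /cylinder /= => -[we].
  by rewrite -[T w]/(iter 1 T w) path_prefix_shift add1n /= /path_prefix /= -we drop0.
Qed.

(** By [markov_step] with [D' = D], the probability [Q e D] is harmonic in [e]. *)
Lemma invariant_measure_cst D : measurable D -> T @^-1` D = D ->
  forall e f, Q e D = Q f D.
Proof.
move=> mD TD.
have QD e : Q e D = (\sum_f (transition R e f)%:E * Q f D)%E.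
  by apply: markov_step => // w f _; rewrite -{1}TD.
have fin e : Q e D \is a fin_num by exact: fin_num_measure.
move=> e f; rewrite -(fineK (fin e)) -(fineK (fin f)); congr EFin.
apply: (harmonic_cst hM (h := fun e => fine (Q e D))) => {e f} e.
apply: EFin_inj; rewrite (fineK (fin e)) QD -sumEFin.
by apply: eq_bigr => f _; rewrite EFinM fineK.
Qed.

(* Given the edges e_1, ..., e_n, the invariant event D has conditional
   probability Q e_n D, which does not depend on e_n: D is independent of every
   cylinder, hence of itself. *)
Lemma invariant_zero_one D : measurable D -> T @^-1` D = D ->
  (forall e, Q e D = 0%E) \/ (forall e, Q e D = 1%E).
Proof.
move=> mD TD.
have [_ /card_gt0P[e0 _] _] := hM.
have Qc e : Q e D = Q e0 D by apply: invariant_measure_cst.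
suff : (Q e0 D * Q e0 D = Q e0 D)%E.
  have fin : Q e0 D \is a fin_num by exact: fin_num_measure.
  rewrite -(fineK fin) -EFinM => -[] /eqP.
  rewrite -subr_eq0 -{3}[fine _]mulr1 -mulrBr mulf_eq0 subr_eq0.
  by case/orP => /eqP p; [left|right] => e; rewrite Qc -(fineK fin) p.
have fin : Q e0 D \is a fin_num by exact: fin_num_measure.
have p0 : 0 <= fine (Q e0 D) by exact: fine_ge0.
pose m1 : {measure set Omega -> \bar R} := mscale (NngNum p0) (Q e0).
pose m2 : {measure set Omega -> \bar R} := mrestr (Q e0) mD.
have sE B : m1 B = (Q e0 D * Q e0 B)%E by rewrite /m1 /= /mscale /= fineK.
have rE B : m2 B = Q e0 (B `&` D) by [].
rewrite -sE.
rewrite -[in RHS](setIid D) -rE.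
have kTD k : iter k T @^-1` D = D.
  elim: k => [//|k IH]; rewrite -[RHS]TD -[in RHS]IH.
  by apply/seteqP; split => w /=; rewrite -iterSr.
apply: (eq_measure_cylinder (m1 := m1) (m2 := m2)) => // [|s].
  by rewrite sE probability_setT mule1 ltey_eq fin.
rewrite sE rE.
case: (lastP s) => [|{}s e]; first by rewrite cylinder_nil probability_setT mule1 setTI.
by rewrite -{2}(kTD (size s)) (markov_property _ _ (hQ e0)) // Qc muleC.
Qed.

End MarkovFamily.

(** * Almost sure upper and lower bounds *)

Lemma archimedean_le (R : realType) (c d : R) : 0 < d ->
  exists K : nat, forall n, (K <= n)%N -> c <= d * n%:R.
Proof.
move=> d0; exists (Num.bound (`|c| / d)) => n Kn.
rewrite mulrC -ler_pdivrMr //.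
apply: (@le_trans _ _ (`|c| / d)).
  by apply: ler_wpM2r (ler_norm c); rewrite invr_ge0 ltW.
apply: le_trans (_ : (Num.bound (`|c| / d))%:R <= _); last by rewrite ler_nat.
by rewrite ltW // archi_boundP // divr_ge0 // ltW.
Qed.

Section AlmostSure.
Variables (R : realType) (A : finType) (M : automaton A).
Variable hM : normal_automaton M.
Variables (F : seq (edge M) -> R) (C : R).
Hypotheses (F_ge0 : forall s, 0 <= F s)
  (F_cat : forall s t, F (s ++ t) <= F s + F t)
  (F_catr : forall s t, F t <= F s + F (s ++ t))
  (F_size : forall s, F s <= C * (size s)%:R).

Local Notation Omega := (sample_space hM).
Local Notation T := (@path_shift A M hM).
Local Notation E := path_expectation.
Local Notation lambda := (drift F).

Variable Q : edge M -> probability Omega R.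
Hypothesis hQ : forall e, markov_measure (start_at R e) (Q e).

(** Borel-Cantelli handles the multiples of [k] with margin d/2. The fewer than [k] letters after
    the last multiple cost at most [C * k], which the other d/2 absorbs for large [n]. *)
Lemma null_upper d : 0 < d -> exists2 D : set Omega,
  measurable D /\ (forall e, Q e D = 0%E) &
  forall w, ~ D w -> exists K, forall n, (K <= n)%N ->
    F (path_prefix w n) <= (lambda + d) * n%:R.
Proof.
move=> d0; have d20 : 0 < d / 2 by lra.
have [k [rho [k0 /andP[rho0 rho1] dev]]] :=
  drift_upper_deviation hM F_ge0 F_cat F_size d20.
pose a J : R := (lambda + d / 2) * (J * k)%:R.
pose U J := [set w : Omega | (a J < F (path_prefix w (J * k)))%R].
have mU J : measurable (U J) by exact: (measurable_path_prefix (fun s => a J < F s)).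
exists (lim_sup_set U); first split.
- by apply: bigcapT_measurable => n; apply: bigcup_measurable.
- move=> e; apply: lim_sup_set_cvg0 => //.
  apply: le_lt_trans (_ : (\sum_(0 <= J <oo) (rho ^+ J)%:E < +oo)%E).
    apply: lee_nneseries => // J _.
    have QE := markov_prefix hQ (J * k) (fun s => a J < F s) e.
    rewrite -[leLHS]/(Q e [set w | (fun s => a J < F s) (path_prefix w (J * k))]).
    by rewrite QE lee_fin dev.
  have rho' : `|rho| < 1 by rewrite ger0_norm.
  rewrite (_ : (fun n => _) = EFin \o series (geometric 1 rho)); last first.
    apply/funext => n; rewrite /series /= sumEFin; congr EFin.
    by apply: eq_bigr => i _; rewrite mul1r.
  have cvg_rho : (EFin \o series (geometric 1 rho)) n @[n --> \oo] --> (1 / (1 - rho))%:E.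
    by apply: cvg_EFin; [exact: nearW | exact: cvg_geometric_series].
  by rewrite (cvg_lim _ cvg_rho) ?ltry.
move=> w /existsNP[J0 /not_implyP[_ HJ]].
have {}HJ J : (J0 <= J)%N -> F (path_prefix w (J * k)) <= a J.
  by move=> J0J; rewrite leNgt; apply/negP => h; apply: HJ; exists J.
have [K HK] := archimedean_le (C * k%:R) d20.
have C0 := bound_ge0 hM F_ge0 F_size.
exists (maxn (J0 * k) K) => n; rewrite geq_max => /andP[J0n /HK Kn].
pose J := (n %/ k)%N.
have Jn : (J * k <= n)%N by exact: leq_divM.
have := F_cat (take (J * k) (path_prefix w n)) (drop (J * k) (path_prefix w n)).
rewrite cat_take_drop take_path_prefix // => h.
have h1 := HJ J (_ : (J0 <= J)%N); have {}h1 := h1 ltac:(by rewrite leq_divRL).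
have h2 : F (drop (J * k) (path_prefix w n)) <= C * k%:R.
  apply: le_trans (F_size _) _; rewrite ler_wpM2l // ler_nat size_drop size_mkseq.
  by rewrite {1}(divn_eq n k) addKn ltnW // ltn_mod.
have h3 : a J <= (lambda + d / 2) * n%:R.
  rewrite ler_wpM2l ?ler_nat //.
  by rewrite addr_ge0 ?(ltW d20) // (drift_ge0 hM F_ge0 F_size).
by lra.
Qed.

Definition slow (r : R) (n : nat) : set Omega :=
  [set w | F (path_prefix w n) <= r * n%:R].

(* The union over j makes the event exactly shift-invariant: shifting changes
   F (path_prefix w n) by at most C. *)
Definition often_slow (r : R) : set Omega :=
  \bigcup_j lim_sup_set (slow (r - j.+1%:R^-1)).

Lemma measurable_often_slow r : measurable (often_slow r).
Proof.
apply: bigcupT_measurable => j; apply: bigcapT_measurable => n.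
apply: bigcup_measurable => m _.
exact: (measurable_path_prefix (fun s => F s <= (r - j.+1%:R^-1) * m%:R)).
Qed.

(** Removing or adding the first letter changes [F] by at most [C] and the length by one; (r' - r) n
    absorbs both for large [n]. Removal relies on [F_catr], addition on [F_cat]. *)
Lemma lim_sup_slow_shift r r' (w : Omega) : r < r' ->
  (lim_sup_set (slow r) w -> lim_sup_set (slow r') (T w)) /\
  (lim_sup_set (slow r) (T w) -> lim_sup_set (slow r') w).
Proof.
move=> rr'; have rr'0 : 0 < r' - r by lra.
pose e1 := @edge_at A M hM w 0.
have pS m : path_prefix w m.+1 = e1 :: path_prefix (T w) m.
  by rewrite -[T w]/(iter 1 T w) path_prefix_shift add1n /path_prefix /= drop0.
have FC : F [:: e1] <= C by have := F_size [:: e1]; rewrite mulr1.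
split=> H N _.
  have [K HK] := archimedean_le (C + r) rr'0.
  have [[//|m] /=] := H (maxn N K).+1 I.
  rewrite ltnS geq_max => /andP[Nm /HK Km] sm.
  exists m => //=; move: sm; rewrite /slow /= pS -natr1 => sm.
  by have := F_catr [:: e1] (path_prefix (T w) m); rewrite /=; lra.
have [K HK] := archimedean_le (C - r') rr'0.
have [m /=] := H (maxn N K) I.
rewrite geq_max => /andP[Nm /HK Km] sm.
exists m.+1; first exact: leqW.
move: sm; rewrite /slow /= pS -natr1 => sm.
by have := F_cat [:: e1] (path_prefix (T w) m); rewrite /=; lra.
Qed.

Lemma often_slow_shift r : T @^-1` often_slow r = often_slow r.
Proof.
(* Each shift is paid for by passing from [j] to [j.+1]. *)
have lt_j j : r - j.+1%:R^-1 < r - j.+2%:R^-1 :> R.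
  by rewrite ltrD2l ltrN2 ltf_pV2 ?posrE ?ltr0n // ltr_nat.
by apply/seteqP; split => w [j _ Hj]; exists j.+1 => //;
  have [H1 H2] := lim_sup_slow_shift w (lt_j j); auto.
Qed.

(** Otherwise the event has probability 1 from every edge, so almost every path has a slow prefix.
    The probability of being bad up to [N] then tends to 0, and [drift_le_bad] gives lambda <= r. *)
Lemma often_slow_null r : r < lambda -> forall e, Q e (often_slow r) = 0%E.
Proof.
move=> rl.
have [//|p1] := invariant_zero_one hQ (measurable_often_slow r) (often_slow_shift r).
have C0 := bound_ge0 hM F_ge0 F_size.
pose B N := [set w : Omega | bad F r N (path_prefix w N)].
have mB N : measurable (B N) by exact: (measurable_path_prefix (fun s => bad F r N s)).
have badE j N (w : Omega) : bad F r N (path_prefix w (N + j)) = bad F r N (path_prefix w N).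
  apply: eq_in_all => m; rewrite mem_iota add0n => /andP[_ mN].
  by rewrite !take_path_prefix // (leq_trans mN) // leq_addr.
have B_dec m n : (m <= n)%N -> (B n `<=` B m)%classic.
  move=> mn w; rewrite /B /= -(subnKC mn) => /allP h.
  apply/allP => i; rewrite mem_iota add0n => /andP[_ im].
  have := h i; rewrite mem_iota add0n (leq_trans im) ?leq_addr // => /(_ isT).
  by rewrite !take_path_prefix // (leq_trans im) // leq_addr.
have B0 e : Q e (\bigcap_N B N) = 0%E.
  apply/eqP; rewrite eq_le measure_ge0 andbT.
  have <- : Q e (~` often_slow r) = 0%E.
    by rewrite probability_setC ?p1 ?subee //; exact: measurable_often_slow.
  apply: le_measure; rewrite ?inE //.
  - exact: bigcapT_measurable.
  - by apply: measurableC; exact: measurable_often_slow.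
  (* Index 1 excludes the empty prefix, which [bad] does not test. *)
  move=> w Bw [j _ /(_ 1%N I)[[//|m] _]]; rewrite /slow /= => sm.
  have := Bw m.+1 I; rewrite /B /= => /allP/(_ m); rewrite mem_iota add0n ltnSn => /(_ isT).
  rewrite take_path_prefix // ltNge => /negP; apply; apply: le_trans sm _.
  by rewrite ler_wpM2r // gerBl invr_ge0.
have Bcvg e : Q e (B N) @[N --> \oo] --> 0%E.
  rewrite -(B0 e); apply: nonincreasing_cvg_mu => //.
  - by rewrite ltey_eq fin_num_measure.
  - exact: bigcapT_measurable.
  - by move=> m n mn; apply/subsetPset/B_dec.
suff : lambda <= r by rewrite leNgt rl.
(* The added 1 makes [K] positive, so that eps / K is a valid tolerance. *)
pose K := C + `|r| + 1.
have K0 : 0 < K by rewrite ltr_wpDl // addr_ge0.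
apply/ler_addgt0Pr => eps eps0.
have eta0 : 0 < eps / K by rewrite divr_gt0.
have /choice[N HN] : forall e, exists N, (Q e (B N) <= (eps / K)%:E)%E.
  move=> e; have /fine_cvg/cvgrPdist_le/(_ _ eta0)[N _ HN] := Bcvg e.
  exists N; have := HN N (leqnn N).
  rewrite /= sub0r normrN ger0_norm ?fine_ge0 // -lee_fin fineK //.
  exact: fin_num_measure.
(* There are finitely many edges and [B] decreases, so one length serves every starting edge. *)
pose N1 := \max_e N e.
apply: le_trans (drift_le_bad hM F_ge0 F_cat F_size (r := r) (N := N1) (eta := eps / K) _) _.
  move=> j e.
  have := markov_prefix hQ (N1 + j) (bad F r N1) e.
  rewrite (_ : [set w | _] = B N1); last by apply/seteqP; split => w; rewrite /B /= badE.
  move=> QE; rewrite -lee_fin -QE; apply: le_trans (HN e).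
  by apply: le_measure; rewrite ?inE //; apply: B_dec; exact: leq_bigmax.
rewrite lerD2l mulrCA ler_piMr ?(ltW eps0) // ler_pdivrMr // mul1r.
by rewrite lerDl.
Qed.

(** One half of [d] puts the threshold below lambda, the other absorbs the offset in
    [often_slow]. *)
Lemma null_lower d : 0 < d -> exists2 D : set Omega,
  measurable D /\ (forall e, Q e D = 0%E) &
  forall w, ~ D w -> exists K, forall n, (K <= n)%N ->
    (lambda - d) * n%:R <= F (path_prefix w n).
Proof.
move=> d0; have d20 : 0 < d / 2 by lra.
exists (often_slow (lambda - d / 2)).
  by split; [exact: measurable_often_slow | apply: often_slow_null; lra].
move=> w nw; have [j Hj] := archimedean_le 1 d20.
have {}Hj : j.+1%:R^-1 <= d / 2 by rewrite -[_^-1]mul1r ler_pdivrMr ?ltr0n // Hj.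
have : ~ lim_sup_set (slow (lambda - d / 2 - j.+1%:R^-1)) w by move=> h; apply: nw; exists j.
move=> /existsNP[K /not_implyP[_ HK]]; exists K => n Kn.
have : ~ slow (lambda - d / 2 - j.+1%:R^-1) n w by move=> h; apply: HK; exists n.
move=> /negP; rewrite -ltNge => /ltW; apply: le_trans.
rewrite ler_wpM2r //; set x := _^-1 in Hj *.
by lra.
Qed.

Lemma cvg_as_drift mu (P : probability Omega R) : markov_measure mu P ->
  {ae P, forall w, F (path_prefix w n) / n%:R @[n --> \oo] --> lambda}.
Proof.
move=> hP.
have null D : measurable D -> (forall e, Q e D = 0%E) -> P D = 0%E.
  by move=> mD QD; rewrite (markov_start hQ hP) // big1 // => e _; rewrite QD mule0.
have aed d : 0 < d -> {ae P, forall w, \forall n \near \oo,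
    `|lambda - F (path_prefix w n) / n%:R| <= d}.
  move=> d0; have [D1 [mD1 QD1] HD1] := null_upper d0.
  have [D2 [mD2 QD2] HD2] := null_lower d0.
  have ae1 : {ae P, forall w, ~ D1 w} by exists D1; split => //; [exact: null|move=> w /contrapT].
  have ae2 : {ae P, forall w, ~ D2 w} by exists D2; split => //; [exact: null|move=> w /contrapT].
  apply: filterS2 ae1 ae2 => w /HD1[K1 HK1] /HD2[K2 HK2].
  exists (maxn 1 (maxn K1 K2)) => // n /=; rewrite !geq_max => /and3P[n0 /HK1 h1 /HK2 h2].
  have nR : 0 < n%:R :> R by rewrite ltr0n.
  by rewrite distrC ler_distl ler_pdivlMr // ler_pdivrMr // h1 h2.
(* Countably many tolerances suffice, and the union of their null sets is null. *)
have /ae_foralln := fun j : nat => aed j.+1%:R^-1 ltac:(by rewrite invr_gt0 ltr0n).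
apply: filterS => w Hw; apply/cvgrPdist_le => eps eps0.
have [j Hj] := archimedean_le 1 eps0.
apply: filterS (Hw j) => n /le_trans; apply.
by rewrite -[_^-1]mul1r ler_pdivrMr ?ltr0n // Hj.
Qed.

End AlmostSure.

(** * Dominated convergence and application to lengths in [G] *)

Lemma cvg_L1_bounded (d : measure_display) (T : measurableType d) (R : realType)
    (P : probability T R) (X : nat -> T -> R) (c C : R) :
  (forall n, measurable_fun setT (X n)) -> (forall n w, `|X n w| <= C) ->
  cvg_as P X (fun=> c) -> cvg_L1 P X (fun=> c).
Proof.
move=> mX XC Xc.
have iC : P.-integrable setT (EFin \o (cst C : T -> R)).
  exact: finite_measure_integrable_cst.
have mEX n := (measurable_EFinP _ _).2 (mX n).
split.
- move=> n; apply: le_integrable iC => // w _ /=.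
  by rewrite lee_fin (le_trans (XC n w)) // ler_norm.
- exact: finite_measure_integrable_cst.
have mc : measurable_fun setT (EFin \o (cst c : T -> R)).
  by apply/measurable_EFinP; exact: measurable_cst.
have EXc : {ae P, forall w, setT w -> (EFin \o X n) w @[n --> \oo] --> (EFin \o cst c) w}.
  by apply: filterS Xc => w Xw _; apply: cvg_EFin; [exact: nearW | exact: Xw].
have EXC : {ae P, forall w n, setT w -> (`|(EFin \o X n) w| <= (EFin \o cst C) w)%E}.
  by apply: nearW => w n _; rewrite /= lee_fin.
by have [_ L1 _] := dominated_convergence measurableT mEX mc EXc iC EXC.
Qed.

Theorem theorem10 (R : realType) (A : finType) (M : automaton A)
    (hM : normal_automaton M) (G : groupType) (dG : G -> G -> R)
    (hd : semi_metric dG) (hinv : left_invariant dG)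
    (phi : seq A -> G) (hphi : word_morphism phi) :
  exists lambda : R, 0 <= lambda /\
    forall (mu : edge M -> R) (hmu : distribution_on mu)
           (P : probability (sample_space hM) R) (hP : markov_measure mu P),
      let X := fun (n : nat) (w : sample_space hM) =>
                 dist1 dG (phi (prefix_word hM w n)) / n%:R in
      cvg_as P X (fun=> lambda) /\ cvg_L1 P X (fun=> lambda).
Proof.
have [d_ge0 dxx dC dtri] := hd; have [phi0 phiD] := hphi.
pose F (s : seq (edge M)) := dist1 dG (phi (map (@label A M) s)).
have F_ge0 s : 0 <= F s by exact: d_ge0.
(* Left invariance turns the length of [h] into the distance from [g] to [g * h]. *)
have dM g h : dG g (g * h)%g = dist1 dG h by rewrite -[in LHS](mulg1 g) -mulgA mul1g hinv.
have F_cat s t : F (s ++ t) <= F s + F t.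
  rewrite /F map_cat phiD -[X in _ <= _ + X](dM (phi (map (@label A M) s))).
  exact: dtri.
(* Triangle inequality from phi(s) to phi(s) phi(t) through 1, with symmetry of [dG]. *)
have F_catr s t : F t <= F s + F (s ++ t).
  rewrite /F map_cat phiD -[leLHS](dM (phi (map (@label A M) s))).
  by rewrite /dist1 [X in _ <= X + _]dC dtri.
(* The sum over all edges dominates the length of each single letter. *)
pose C := \sum_e F [:: e].
have F1 e : F [:: e] <= C by rewrite /C (bigD1 e) //= lerDl sumr_ge0.
have F_size s : F s <= C * (size s)%:R.
  elim: s => [|e s IH]; first by rewrite /F /= phi0 mulr0 /dist1 dxx.
  rewrite /= -natr1 mulrDr mulr1 addrC.
  by apply: le_trans (F_cat [:: e] s) _; rewrite lerD.
have XE n (w : sample_space hM) : dist1 dG (phi (prefix_word hM w n)) = F (path_prefix w n).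
  by rewrite /F /path_prefix /mkseq -map_comp.
exists (drift F); split; first exact: (drift_ge0 hM F_ge0 F_size).
move=> mu hmu P hP X.
have [Q hQ] := exists_markov_family hmu hP.
have Xas : cvg_as P X (fun=> drift F).
  apply: filterS (cvg_as_drift F_ge0 F_cat F_catr F_size hQ hP) => w.
  by under eq_fun do rewrite -XE.
split=> //; apply: (@cvg_L1_bounded _ _ _ _ _ _ C) => // [n _ Y mY|n w].
  rewrite setTI (_ : _ @^-1` _ = [set w | Y (F (path_prefix w n) / n%:R)]).
    exact: (measurable_path_prefix (fun s => Y (F s / n%:R))).
  by apply/seteqP; split => w; rewrite /X /= XE.
(* At [n = 0] the quotient is 0, since the inverse of 0 is 0 by convention. *)
rewrite /X XE ger0_norm ?divr_ge0 //; have [->|n0] := posnP n.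
  by rewrite invr0 mulr0 (bound_ge0 hM F_ge0 F_size).
by rewrite ler_pdivrMr ?ltr0n // (le_trans (F_size _)) // size_mkseq.
Qed.
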